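(* Let $\mathrm{k}$ be a field, let $d \ge 2$, and let $n = kd + r$ where $k, r$ are positive integers with $1 \le r \le d$. Let $S = \mathrm{k}[x_1,\ldots,x_n]$ be the standard graded polynomial ring and let $I_{n,d}\subset S$ be the $d$-path ideal of an $n$-cycle. Then for all integers $s \ge 1$, $$e_0(S/I_{n,d}^s) = \left( d\binom{k+d-r}{k} - \binom{k+d-r}{k+1}\right)\binom{k+s}{s-1}.$$
   Context: The $d$-path ideal of an $n$-cycle is $I_{n,d} = (g_1,\ldots,g_n)$ where $g_i = x_i x_{i+1}\cdots x_{i+d-1}$, with indices of the variables read modulo $n$ in $\{1,\ldots,n\}$; that is, $g_1 = x_1\cdots x_d$, $g_2 = x_2\cdots x_{d+1}$, ..., $g_n = x_n x_1\cdots x_{d-1}$. As usual, $\binom{a}{b}=0$ for integers $0\le a<b$. Multiplicity: for a nonzero finitely generated graded $S$-module $M$ of Krull dimension $D$, there is a Laurent polynomial $Q_M(t)\in\mathbb{Z}[t,t^{-1}]$ with $Q_M(1)>0$ such that $\sum_{a\in\mathbb{Z}} \dim_{\mathrm{k}}(M_a)\,t^a = Q_M(t)/(1-t)^D$. The multiplicity of $M$ is $e_0(M) = Q_M(1)$. Equivalently, when $D\ge 1$, $e_0(M)/(D-1)!$ is the leading coefficient (of $a^{D-1}$) of the Hilbert polynomial that agrees with $\dim_{\mathrm{k}} M_a$ for $a\gg 0$; when $D=0$, $e_0(M)=\dim_{\mathrm{k}} M$. *)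

(* Defs.v *)
From HB Require Import structures.
From mathcomp Require Import all_boot all_order all_algebra.
From mathcomp Require Import boolp mpoly.

Set Implicit Arguments.
Unset Strict Implicit.
Unset Printing Implicit Defensive.

Import Order.TTheory GRing.Theory Num.Theory.

Local Open Scope ring_scope.

Section Ideals.
Variable A : comNzRingType.

(* Ideals are boolean predicates; membership is made boolean by the excluded
   middle, so that the predicates [idealr_closed] (proper ideal) and
   [prime_idealr_closed] of MathComp apply. *)
Definition ideal_span (G : A -> Prop) : {pred A} := [pred p |
  `[< exists (m : nat) (c g : 'I_m -> A),
        (forall i, G (g i)) /\ p = \sum_(i < m) c i * g i >]].

Definition ideal_mul (I J : {pred A}) : {pred A} :=
  ideal_span (fun p => exists u v, [/\ u \in I, v \in J & p = u * v]).

Fixpoint ideal_exp (I : {pred A}) (s : nat) : {pred A} :=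
  if s is s'.+1 then ideal_mul I (ideal_exp I s') else [pred _ | true].

Definition prime_ideal (P : {pred A}) : Prop :=
  idealr_closed P /\ prime_idealr_closed P.

(* A strict chain P_0 < P_1 < ... < P_l of prime ideals of A containing J,
   i.e. a chain of length l of prime ideals of the quotient ring A / J. *)
Definition prime_chain (J : {pred A}) (l : nat) (P : nat -> {pred A}) : Prop :=
  [/\ forall i, (i <= l)%N -> prime_ideal (P i),
      {subset J <= P 0%N}
    & forall i, (i < l)%N ->
        {subset P i <= P i.+1} /\ exists2 p, p \in P i.+1 & p \notin P i].

Definition quotient_krull_dim (J : {pred A}) (D : nat) : Prop :=
  (exists P, prime_chain J D P) /\
  (forall l P, prime_chain J l P -> (l <= D)%N).

End Ideals.

Section Multiplicity.
Variables (K : fieldType) (n : nat).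
Implicit Type J : {pred {mpoly K[n]}}.

(* dim_K (S / J)_t = m: the classes modulo J of the m forms b_i of degree t
   are a K-basis of the image of S_t in S / J. *)
Definition hilbert_value J (t m : nat) : Prop :=
  exists b : 'I_m -> {mpoly K[n]},
    (forall i, b i \is t.-homog) /\
    (forall p : {mpoly K[n]}, p \is t.-homog ->
       exists! c : 'rV[K]_m, p - \sum_(i < m) c 0 i *: b i \in J).

(* H(t) = Q(t) / (1 - t)^D as formal power series, with the denominator
   cleared: the left-hand side is the a-th coefficient of (1 - t)^D H(t). *)
Definition hilbert_series_eq (H : nat -> nat) (Q : {poly int}) (D : nat) : Prop :=
  forall a : nat,
    \sum_(i < a.+1) ((1 - 'X) ^+ D : {poly int})`_i * (H (a - i)%N)%:Z = Q`_a.

(* e_0 (S / J) = e, for a proper homogeneous ideal J.  As S / J vanishes in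
   negative degrees, the Laurent polynomial Q is an ordinary polynomial. *)
Definition multiplicity J (e : int) : Prop :=
  exists (D : nat) (H : nat -> nat) (Q : {poly int}),
    [/\ quotient_krull_dim J D,
        forall a, hilbert_value J a (H a),
        hilbert_series_eq H Q D,
        0 < Q.[1]
      & e = Q.[1]].

Lemma hilbert_value_uniq J a m1 m2 : idealr_closed J ->
  hilbert_value J a m1 -> hilbert_value J a m2 -> m1 = m2.
Proof.
case=> J0 _ Jlin.
have JD p q : p \in J -> q \in J -> p + q \in J.
  by move=> pJ qJ; rewrite -[p]mul1r; apply: Jlin.
have JM p q : q \in J -> p * q \in J.
  by move=> qJ; rewrite -[_ * _]addr0; apply: Jlin.
have JZ c q : q \in J -> c *: q \in J by rewrite -mul_mpolyC; exact: JM.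
have le k l : hilbert_value J a k -> hilbert_value J a l -> (k <= l)%N.
  move=> [b [bh bP]] [b' [bh' bP']].
  have /boolp.choice[f fP] : forall i, exists c : 'rV[K]_l,
      b i - \sum_(j < l) c 0 j *: b' j \in J.
    by move=> i; have [c [cP _]] := bP' _ (bh i); exists c.
  have /boolp.choice[g gP] : forall i, exists c : 'rV[K]_k,
      b' i - \sum_(j < k) c 0 j *: b j \in J.
    by move=> i; have [c [cP _]] := bP _ (bh' i); exists c.
  apply: (@mulmx1_min K k l (\matrix_i f i) (\matrix_i g i)).
  apply/row_matrixP => i.
  have [c [_ cU]] := bP _ (bh i).
  rewrite -(cU (row i 1%:M)) => [|]; last first.
    rewrite (bigD1 i) //= big1 => [|j ji]; last first.
      by rewrite !mxE eq_sym (negPf ji) scale0r.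
    by rewrite !mxE eqxx scale1r addr0 subrr.
  symmetry; apply: cU.
  have -> : \sum_(j < k) row i (\matrix_i0 f i0 *m \matrix_i0 g i0) 0 j *: b j
          = \sum_(h < l) f i 0 h *: \sum_(j < k) g h 0 j *: b j.
    under [RHS]eq_bigr do rewrite scaler_sumr.
    rewrite exchange_big /=; apply: eq_bigr => j _.
    rewrite !mxE scaler_suml; apply: eq_bigr => h _.
    by rewrite !mxE scalerA.
  rewrite -[b i](subrK (\sum_(j < l) f i 0 j *: b' j)) -addrA.
  apply: (JD) => //; rewrite -sumrB.
  apply: (big_ind (fun p => p \in J)) => // h _.
  by rewrite -scalerBr; exact/JZ/gP.
by move=> h1 h2; apply/eqP; rewrite eqn_leq !le.
Qed.

Lemma multiplicity_uniq J e1 e2 : idealr_closed J ->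
  multiplicity J e1 -> multiplicity J e2 -> e1 = e2.
Proof.
move=> Jid [D1 [H1 [Q1 [[[P1 c1] m1] h1 s1 _ ->]]]].
move=> [D2 [H2 [Q2 [[[P2 c2] m2] h2 s2 _ ->]]]].
have eD : D1 = D2.
  by apply/eqP; rewrite eqn_leq (m2 _ _ c1) (m1 _ _ c2).
congr (_.[1]); apply/polyP => a; rewrite -s1 -s2 eD.
by apply: eq_bigr => i _; rewrite (hilbert_value_uniq Jid (h1 _) (h2 _)).
Qed.

End Multiplicity.

(* The variables are indexed by 'I_n = {0, ..., n - 1}, on which [ordS] is the
   cyclic successor, so [iter j (@ordS n) i] is i + j modulo n. *)
Definition path_gen (K : fieldType) (n d : nat) (i : 'I_n) : {mpoly K[n]} :=
  \prod_(j < d) 'X_(iter j (@ordS n) i).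

Definition cycle_path_ideal (K : fieldType) (n d : nat) : {pred {mpoly K[n]}} :=
  ideal_span (fun p => exists i : 'I_n, p = path_gen K d i).

Arguments cycle_path_ideal K n d : clear implicits.

(* Main.v *)
Require Import Defs.
From mathcomp Require Import all_boot all_order all_algebra.
From mathcomp Require Import boolp mpoly.
From mathcomp Require Import zify.

(** Both sides of the formula are read off the standard monomials of [I^s].

    For any family of edges on [n] vertices, with [h] the least size of a vertex
    cover, a monomial [x^m] lies in the [s]-th power of the edge ideal iff
    [x^min(m,s)] does. Hence the monomials outside [I^s] are partitioned into
    cells [min(m,s) = v], and the cell of [v] has the Hilbert series
    [t^|v| / (1 - t)^f] with [f] the number of coordinates of [v] equal to [s].
    The vertices where [v < s] form a vertex cover, so [f <= n - h], and the
    multiplicity counts the [v] with [f = n - h]. Over a minimum cover [X], where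
    every vertex of [X] has a private edge, these are the [v] with
    [sum_(j in X) v_j < s]; there are ['C(h + s - 1, h)] of them.

    That the Krull dimension is [n - h] is elementary as well: members of the
    successive differences of a chain of primes are algebraically independent
    modulo the smallest prime, which bounds the length of the chain by counting
    monomials.

    On the cycle, [h = k + 1], and a minimum cover [c_0 < ... < c_k] is a
    sequence with gaps at most [d], the cyclic one included. Writing
    [c_j = c_0 + j d - b_j] gives a nondecreasing [b] with values in
    [0, ..., d - r] and [c_0 < r + b_k]; of the [d 'C(k + d - r, k)] pairs
    [(c_0, b)] with [c_0 < d], those with [c_0 - r >= b_k] are the nondecreasing
    sequences [(b_1, ..., b_k, c_0 - r)] below [d - r]. *)

Set Implicit Arguments.
Unset Strict Implicit.
Unset Printing Implicit Defensive.

Import Order.TTheory GRing.Theory Num.Theory.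

Local Open Scope ring_scope.

(** * Powers of squarefree monomial ideals *)

Section IdealSpan.
Variable A : comNzRingType.
Implicit Types (G : A -> Prop) (J : {pred A}).

Lemma ideal_spanM G c g : G g -> c * g \in ideal_span G.
Proof.
move=> Gg; apply/asboolP; exists 1%N, (fun=> c), (fun=> g).
by rewrite big_ord1.
Qed.

Lemma ideal_span0 G : 0 \in ideal_span G.
Proof.
apply/asboolP; exists 0%N, (fun=> 0), (fun=> 0).
by rewrite big_ord0; split=> // -[].
Qed.

Lemma ideal_spanD G : {in ideal_span G &, forall p q, p + q \in ideal_span G}.
Proof.
move=> _ _ /asboolP[m1 [c1 [g1 [G1 ->]]]] /asboolP[m2 [c2 [g2 [G2 ->]]]].
apply/asboolP; exists (m1 + m2)%N.
exists (fun i => match split i with inl j => c1 j | inr j => c2 j end).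
exists (fun i => match split i with inl j => g1 j | inr j => g2 j end).
split; first by move=> i; case: (split i).
rewrite big_split_ord /=; congr (_ + _); apply: eq_bigr => i _.
  by rewrite (unsplitK (inl i)).
by rewrite (unsplitK (inr i)).
Qed.

Lemma ideal_span_min G J :
    0 \in J -> {in J &, forall p q, p + q \in J} ->
    (forall c p, p \in J -> c * p \in J) -> (forall g, G g -> g \in J) ->
  {subset ideal_span G <= J}.
Proof.
move=> J0 JD JM GJ _ /asboolP[m [c [g [Gg ->]]]].
by apply: (big_ind (fun p => p \in J)) => // i _; apply/JM/GJ.
Qed.

End IdealSpan.

Section MonomialIdeals.
Variables (K : fieldType) (n : nat).
Implicit Types (A B C : pred 'X_{1..n}) (p q : {mpoly K[n]}) (m : 'X_{1..n}).

(** The [K]-span of the monomials with exponent in [A]. Monomial ideals are the case of [upward]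
    predicates, so ideal membership becomes a statement about exponents. *)
Definition supported A : {pred {mpoly K[n]}} := [pred p | all A (msupp p)].

Definition upward A := forall m1 m2, (m1 <= m2)%MM -> A m1 -> A m2.

Lemma supportedP A p :
  reflect (forall m, p@_m != 0 -> A m) (p \in supported A).
Proof.
apply: (iffP allP) => Ap m; first by rewrite -mcoeff_msupp; apply: Ap.
by rewrite mcoeff_msupp; apply: Ap.
Qed.

Lemma supported0 A : 0 \in supported A.
Proof. by apply/supportedP => m; rewrite mcoeff0 eqxx. Qed.

Lemma supportedD A : {in supported A &, forall p q, p + q \in supported A}.
Proof.
move=> p q /supportedP Ap /supportedP Aq; apply/supportedP => m.
rewrite mcoeffD; apply: contraR => nA.
have /negPn/eqP -> : ~~ (p@_m != 0) by apply: contra nA; apply: Ap.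
have /negPn/eqP -> : ~~ (q@_m != 0) by apply: contra nA; apply: Aq.
by rewrite addr0.
Qed.

Lemma supportedM A B C :
    (forall m1 m2, A m1 -> B m2 -> C (m1 + m2)%MM) ->
  forall p q, p \in supported A -> q \in supported B -> p * q \in supported C.
Proof.
move=> ABC p q /allP Ap /allP Bq; apply/allP => m /msuppM_le.
by case/allpairsP=> -[m1 m2] /= [/Ap Am /Bq Bm ->]; apply: ABC.
Qed.

Lemma supportedX A m : ('X_[m] \in supported A) = A m.
Proof. by rewrite inE msuppX /= andbT. Qed.

(** [upward A] makes the right-hand side an ideal; conversely each monomial of [p] is a multiple of
    a generator. Elements of [G] may be arbitrary polynomials, as the products in [ideal_mul]
    are. *)
Lemma ideal_span_supported (G : {mpoly K[n]} -> Prop) A :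
    upward A -> (forall g, G g -> g \in supported A) ->
    (forall m, A m -> exists c g, G g /\ 'X_[m] = c * g) ->
  ideal_span G =i supported A.
Proof.
move=> upA GA AG p; apply/idP/idP; last first.
  move=> /allP Ap; rewrite (mpolyE p) big_seq.
  apply: (big_ind (fun p => p \in ideal_span G)).
  - exact: ideal_span0.
  - exact: ideal_spanD.
  move=> m /Ap /AG[c [g [Gg ->]]].
  by rewrite -mul_mpolyC mulrA; apply: ideal_spanM.
apply: ideal_span_min => //.
- exact: supported0.
- exact: supportedD.
move=> c q; apply: (@supportedM predT) => [m1 m2 _|].
  exact/upA/lem_addl.
exact/allP.
Qed.

Lemma ideal_mul_supported (I J : {pred {mpoly K[n]}}) A B C :
    I =i supported A -> J =i supported B -> upward C ->
    (forall m1 m2, A m1 -> B m2 -> C (m1 + m2)%MM) ->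
    (forall m, C m -> exists m1 m2, [/\ A m1, B m2 & (m1 + m2 <= m)%MM]) ->
  ideal_mul I J =i supported C.
Proof.
move=> IA JB upC ABC CAB; apply: ideal_span_supported => // [g|m /CAB].
  by case=> u [v []]; rewrite IA JB => Iu Jv ->; apply: (supportedM ABC).
case=> m1 [m2 [Am1 Bm2 le_m]]; exists 'X_[m - (m1 + m2)], 'X_[m1 + m2].
rewrite -mpolyXD submK //; split=> //.
by exists 'X_[m1], 'X_[m2]; rewrite IA JB !supportedX -mpolyXD.
Qed.

(** The monomials of degree [a] outside [A] form the basis; the coordinates of [p] are its
    coefficients there. *)
Lemma hilbert_value_supported (J : {pred {mpoly K[n]}}) A (a : nat)
    (s : seq 'X_{1..n}) :
    J =i supported A -> uniq s ->
    (forall m, (m \in s) = (mdeg m == a) && ~~ A m) ->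
  hilbert_value J a (size s).
Proof.
move=> JA us sP; exists (fun i => 'X_[tnth (in_tuple s) i]); split=> [i|p hp].
  by rewrite dhomogX; have := mem_tnth i (in_tuple s); rewrite sP => /andP[].
have coefS (c : 'rV[K]_(size s)) i :
    (\sum_(j < size s) c 0 j *: 'X_[tnth (in_tuple s) j])@_(tnth (in_tuple s) i)
    = c 0 i.
  rewrite raddf_sum /= (bigD1 i) //= mcoeffZ mcoeffX eqxx mulr1 big1 ?addr0 //.
  move=> j ji; rewrite mcoeffZ mcoeffX; case: eqP => [/eqP|_]; rewrite ?mulr0 //.
  by rewrite (inj_eq (tuple_uniqP (in_tuple s) us)) (negPf ji).
exists (\row_i p@_(tnth (in_tuple s) i)); split=> [|c].
  rewrite JA; apply/supportedP => m; apply: contraR => nAm.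
  rewrite mcoeffB; have [ms|] := boolP (m \in s).
    have /tnthP[i ->] : m \in in_tuple s by [].
    by rewrite coefS mxE subrr.
  move=> nms; rewrite raddf_sum /= big1 => [|i _].
    rewrite subr0; apply/eqP/(dhomog_nemf_coeff hp).
    by apply: contra nms => dm; rewrite sP dm.
  rewrite mcoeffZ mcoeffX; case: eqP => [eqm|_]; rewrite ?mulr0 //.
  by case/negP: nms; rewrite -eqm mem_tnth.
rewrite JA => /supportedP cP; apply/rowP => i; rewrite mxE.
have := mem_tnth i (in_tuple s); rewrite sP => /andP[_ nA].
apply/eqP; rewrite -subr_eq0 -(coefS c i) -mcoeffB.
by apply: contraR nA; apply: cP.
Qed.

Section Edges.
Variables (T : finType) (e : T -> {set 'I_n}).

Definition mnm_set (D : {set 'I_n}) : 'X_{1..n} :=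
  [multinom (j \in D : nat) | j < n].

Definition edge_ideal : {pred {mpoly K[n]}} :=
  ideal_span (fun p => exists i, p = 'X_[mnm_set (e i)]).

Definition vertex_cover (X : {set 'I_n}) := [forall i, ~~ [disjoint e i & X]].

(** The exponents of the monomials in the [s]-th power of the edge ideal; a tuple, because edges may
    repeat. *)
Definition power_gens (s : nat) m :=
  [exists t : s.-tuple T, (\sum_(i <- t) mnm_set (e i) <= m)%MM].

Lemma power_gens_upward s : upward (power_gens s).
Proof.
move=> m1 m2 m12 /existsP[t tm]; apply/existsP; exists t.
exact: lepm_trans tm m12.
Qed.

Lemma power_gensD (s1 s2 : nat) m1 m2 :
  power_gens s1 m1 -> power_gens s2 m2 -> power_gens (s1 + s2) (m1 + m2)%MM.
Proof.
move=> /existsP[t1 /mnm_lepP t1m] /existsP[t2 /mnm_lepP t2m].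
apply/existsP; exists (cat_tuple t1 t2); rewrite big_cat /=.
by apply/mnm_lepP => j; rewrite !mnmDE leq_add.
Qed.

Lemma edge_ideal_supported : edge_ideal =i supported (power_gens 1).
Proof.
apply: ideal_span_supported => [|_ [i ->]|m /existsP[t]].
- exact: power_gens_upward.
- rewrite supportedX; apply/existsP; exists [tuple i].
  by rewrite big_seq1 lepm_refl.
case: t => -[|i []] //= t1; rewrite big_seq1 => le_m.
exists 'X_[m - mnm_set (e i)], 'X_[mnm_set (e i)]; rewrite -mpolyXD submK //.
by split=> //; exists i.
Qed.

Lemma edge_ideal_exp_supported s :
  ideal_exp edge_ideal s =i supported (power_gens s).
Proof.
elim: s => [p|s IHs].
  rewrite !inE; symmetry; apply/allP => m _; apply/existsP; exists [tuple].
  by rewrite big_nil; apply/mnm_lepP => j; rewrite mnm0E.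
apply: (ideal_mul_supported edge_ideal_supported IHs).
- exact: power_gens_upward.
- by move=> m1 m2; apply: power_gensD.
move=> m /existsP[t tm].
exists (mnm_set (e (thead t))), (\sum_(i <- behead_tuple t) mnm_set (e i))%MM.
split.
- by apply/existsP; exists [tuple thead t]; rewrite big_seq1 lepm_refl.
- by apply/existsP; exists (behead_tuple t); rewrite lepm_refl.
by move: tm; rewrite {1}(tuple_eta t) big_cons.
Qed.

End Edges.
End MonomialIdeals.

Arguments edge_ideal K {n T} e.

(** * Krull dimension *)

Lemma big_tuple_cons (R : Type) (idx : R) (op : Monoid.com_law idx)
    (T : finType) (l : nat) (F : l.+1.-tuple T -> R) :
  \big[op/idx]_t F t =
  \big[op/idx]_(x : T) \big[op/idx]_(t : l.-tuple T) F [tuple of x :: t].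
Proof.
rewrite pair_bigA (reindex (fun u : T * l.-tuple T => [tuple of u.1 :: u.2])) //.
exists (fun t => (thead t, behead_tuple t)) => [[x t] _|t _] /=.
  by rewrite theadE; congr (_, _); apply: val_inj.
by rewrite [RHS]tuple_eta.
Qed.

Section PrimeChains.
Variables (K : fieldType) (A : comAlgType K).
Implicit Type P : {pred A}.

Lemma idealMD P (a u v : A) :
  idealr_closed P -> u \in P -> v \in P -> a * u + v \in P.
Proof. by case=> _ _; apply. Qed.

Lemma idealM P (a u : A) : idealr_closed P -> u \in P -> a * u \in P.
Proof. by move=> idP uP; rewrite -[_ * _]addr0 idealMD //; case: idP. Qed.

Lemma idealBr P (u v : A) :
  idealr_closed P -> u + v \in P -> v \in P -> u \in P.
Proof.
move=> idP uvP vP; rewrite -[u](addrK v) addrC -mulN1r.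
exact: idealMD.
Qed.

Lemma ideal_sum P I (r : seq I) (Q : pred I) (F : I -> A) :
    idealr_closed P -> (forall i, Q i -> F i \in P) ->
  \sum_(i <- r | Q i) F i \in P.
Proof.
move=> idP FP; apply: (big_ind (fun u => u \in P)) => //; first by case: idP.
by move=> u v uP vP; rewrite -[u]mul1r idealMD.
Qed.

Lemma prime_idealX P u k : prime_ideal P -> u ^+ k \in P -> u \in P.
Proof.
case=> -[_ P1 _] prP; elim: k => [|k IHk]; first by rewrite expr0 (negPf P1).
by rewrite exprS => /prP/orP[].
Qed.

Lemma prime_ideal_prod P I (r : seq I) (F : I -> A) :
  prime_ideal P -> \prod_(i <- r) F i \in P -> exists i, F i \in P.
Proof.
case=> -[_ P1 _] prP; elim: r => [|i r IHr]; first by rewrite big_nil (negPf P1).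
by rewrite big_cons => /prP/orP[|/IHr//]; exists i.
Qed.

(* Dividing the sum by the power of x in front of its lowest nonzero
   coefficient shows that this coefficient lies in P1. *)
Lemma prime_pair_independent P0 P1 (x : A) N (g : 'I_N -> A) :
    prime_ideal P0 -> prime_ideal P1 -> {subset P0 <= P1} ->
    x \in P1 -> x \notin P0 -> (forall i, g i \in P1 -> g i = 0) ->
  \sum_(i < N) x ^+ i * g i \in P0 -> forall i, g i = 0.
Proof.
move=> prP0 [idP1 _] P01 xP1 nxP0 gP gsum i.
have [k] := ubnP (nat_of_ord i); elim: k i => // k IHk i /ltnSE le_ik; apply: gP.
pose h := \sum_(j < N | (i < j)%N) x ^+ (j - i.+1) * g j.
suff : x ^+ i * (g i + x * h) \in P0.
  case/prP0.2/orP => [/(prime_idealX prP0)|/P01]; first by rewrite (negPf nxP0).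
  by move=> ghP1; apply: (idealBr idP1 ghP1); rewrite mulrC idealM.
suff <- : \sum_(j < N) x ^+ j * g j = x ^+ i * (g i + x * h) by [].
rewrite (bigID (fun j : 'I_N => (i < j)%N)) /= addrC mulrDr; congr (_ + _).
  rewrite (bigD1 i) ?ltnn //= big1 ?addr0 // => j; rewrite -leqNgt => /andP[ji nji].
  by rewrite IHk ?mulr0 //; apply: leq_trans le_ik; rewrite ltn_neqAle nji.
rewrite mulrA -exprSr mulr_sumr; apply: eq_bigr => j ij.
by rewrite mulrA -exprD subnKC.
Qed.

Definition prime_flag (l : nat) (P : nat -> {pred A}) (f : nat -> A) :=
  (forall i, (i <= l)%N -> prime_ideal (P i)) /\
  forall i, (i < l)%N ->
    [/\ {subset P i <= P i.+1}, f i \in P i.+1 & f i \notin P i].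

(** Induction on [l], sorting the sum by powers of [f 0]. The coefficients [g x] are polynomials in
    the later [f i]; by induction along the chain starting at [P 1], [g x] vanishes as soon as it
    lies in [P 1], which is what [prime_pair_independent] asks for. *)
Lemma prime_flag_independent l (P : nat -> {pred A}) (f : nat -> A) N (c : l.-tuple 'I_N -> K) :
    prime_flag l P f ->
    \sum_t c t *: \prod_(i < l) f i ^+ tnth t i \in P 0%N ->
  forall t, c t = 0.
Proof.
elim: l P f c => [|l IHl] P f c [prP fP].
  rewrite (big_pred1 [tuple]) => [|t]; last by rewrite (tuple0 t) /= eqxx.
  (* A nonzero constant in [P 0] would put 1 there. *)
  rewrite big_ord0 => cP t; rewrite tuple0; apply: contraTeq cP => c0.
  apply/negP => /(idealM (c [tuple])^-1%:A (prP 0%N isT).1).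
  by rewrite -scalerAl mul1r scalerA mulVf // scale1r; case: (prP 0%N isT) => -[_ /negPf ->].
pose g (x : 'I_N) :=
  \sum_(t : l.-tuple 'I_N) c [tuple of x :: t] *: \prod_(i < l) f i.+1 ^+ tnth t i.
have flagS : prime_flag l (fun i => P i.+1) (fun i => f i.+1).
  by split=> i il; [apply: prP | apply: fP].
have gP x : g x \in P 1%N -> forall t : l.-tuple 'I_N, c [tuple of x :: t] = 0.
  exact: (IHl _ _ (fun t : l.-tuple 'I_N => c [tuple of x :: t]) flagS).
rewrite big_tuple_cons => sumP.
have sumE : \sum_(x < N) f 0%N ^+ x * g x \in P 0%N.
  move: sumP; congr (is_true (_ \in P 0%N)); apply: eq_bigr => x _.
  rewrite mulr_sumr; apply: eq_bigr => t _.
  rewrite -scalerAr big_ord_recl /=; congr (_ *: (_ * _)).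
    by apply: eq_bigr => i _; rewrite (tnthS x t).
have [P01 f1 nf0] := fP 0%N isT.
have g0 := prime_pair_independent (prP 0%N isT) (prP 1%N isT) P01 f1 nf0 _ sumE.
move=> t; rewrite (tuple_eta t); apply: (gP); rewrite g0.
  by case: (prP 1%N isT) => -[].
move=> x gx; rewrite /g big1 // => u _.
by rewrite (gP _ gx) scale0r.
Qed.

End PrimeChains.

(** * Primes generated by variables and the length of prime chains *)

Section MonomialPrimes.
Variables (K : fieldType) (n : nat).
Implicit Types (X : {set 'I_n}) (p : {mpoly K[n]}) (m : 'X_{1..n}).

Definition meets X m := [exists (j | j \in X), m j != 0%N].

Definition kill_tuple X : n.-tuple {mpoly K[n]} :=
  [tuple if i \in X then 0 else 'X_i | i < n].

Lemma kill_mpolyX X m :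
  'X_[m] \mPo kill_tuple X = if meets X m then 0 else 'X_[m].
Proof.
rewrite comp_mpolyX; case: ifPn => [/existsP[j /andP[jX mj]]|nXm].
  by rewrite (bigD1 j) //= tnth_mktuple jX expr0n (negPf mj) mul0r.
rewrite [RHS]mpolyXE_id; apply: eq_bigr => j _; rewrite tnth_mktuple.
case: ifP => // jX; move: nXm; rewrite negb_exists => /forallP/(_ j).
by rewrite jX negbK => /eqP ->; rewrite !expr0.
Qed.

(** The substitution erases exactly the monomials that meet [X]. This presents the ideal of the
    variables in [X] as the kernel of a ring morphism into a domain, whence its primality. *)
Lemma kill_mpoly_eq0 X p :
  (p \mPo kill_tuple X == 0) = (p \in supported (meets X)).
Proof.
apply/eqP/idP => [p0|/allP Xp]; last first.
  rewrite comp_mpolyEX big_seq big1 // => m /Xp Xm.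
  by rewrite kill_mpolyX Xm scaler0.
rewrite -[p]subr0 -p0 {1}(mpolyE p) comp_mpolyEX -sumrB.
apply: (big_ind (fun q => q \in supported (meets X))).
- exact: supported0.
- exact: supportedD.
move=> m _; rewrite kill_mpolyX; case: ifPn => Xm.
  rewrite scaler0 subr0; apply/supportedP => m'; rewrite mcoeffZ mcoeffX.
  by have [<- //|_] := eqVneq m m'; rewrite mulr0 eqxx.
by rewrite subrr supported0.
Qed.

Lemma meets_prime X : prime_ideal (supported (meets X) : {pred {mpoly K[n]}}).
Proof.
split=> [|u v]; last by rewrite -!kill_mpoly_eq0 rmorphM mulf_eq0.
split=> [||a u v]; rewrite -!kill_mpoly_eq0.
- by rewrite rmorph0.
- by rewrite rmorph1 oner_eq0.
by move=> /eqP u0 /eqP v0; rewrite rmorphD rmorphM /= u0 v0 mulr0 addr0.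
Qed.

Lemma variables_in_ideal (P : {pred {mpoly K[n]}}) X p :
    idealr_closed P -> (forall j, j \in X -> 'X_j \in P) ->
  p \in supported (meets X) -> p \in P.
Proof.
move=> idP XP /allP Xp; rewrite (mpolyE p) big_seq; apply: ideal_sum => // m.
move=> /Xp/existsP[j /andP[jX mj]]; rewrite -mul_mpolyC idealM //.
rewrite -(@submK _ U_(j)%MM m) ?lep1mP // mpolyXD idealM //.
exact: XP.
Qed.

Lemma row_dependent (I J : finType) (M : I -> J -> K) : (#|J| < #|I|)%N ->
  exists2 c : I -> K, exists i, c i != 0 & forall j, \sum_i c i * M i j = 0.
Proof.
move=> ltJI; pose B : 'M_(#|I|, #|J|) := \matrix_(i, j) M (enum_val i) (enum_val j).
have /rowV0Pn[v /sub_kermxP vB v0] : kermx B != 0.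
  rewrite kermx_eq0 /row_free neq_ltn; apply/orP; left.
  exact: leq_ltn_trans (rank_leq_col _) ltJI.
exists (fun i => v 0 (enum_rank i)) => [|j].
  have /existsP[i vi] : [exists i, v 0 i != 0].
    apply: contraNT v0; rewrite negb_exists => /forallP v0.
    by apply/eqP/rowP => i; rewrite mxE; apply/eqP; move: (v0 i); rewrite negbK.
  by exists (enum_val i); rewrite enum_valK.
have := congr1 (fun w : 'rV_#|J| => w 0 (enum_rank j)) vB.
rewrite !mxE (reindex enum_rank) /=; last exact/onW_bij/enum_rank_bij.
by move=> vj; rewrite -[RHS]vj; apply: eq_bigr => i _; rewrite mxE !enum_rankK.
Qed.

(** Bounding each exponent, rather than the degree, lets monomials be counted as functions into an
    ordinal; the bounds add up in products. *)
Definition box (b : nat) m := [forall j, m j <= b]%N.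

Lemma supported_boxM b1 b2 p q :
  p \in supported (box b1) -> q \in supported (box b2) ->
  p * q \in supported (box (b1 + b2)).
Proof.
apply: supportedM => m1 m2 /forallP m1b /forallP m2b.
by apply/forallP => j; rewrite mnmDE leq_add.
Qed.

Lemma supported_boxX b p k :
  p \in supported (box b) -> p ^+ k \in supported (box (k * b)).
Proof.
move=> pb; elim: k => [|k IHk]; last by rewrite exprS mulSn supported_boxM.
by rewrite expr0 -mpolyX0 supportedX; apply/forallP => j; rewrite mnm0E.
Qed.

Lemma supported_box_prod l (b : 'I_l -> nat) (p : 'I_l -> {mpoly K[n]}) :
    (forall i, p i \in supported (box (b i))) ->
  \prod_i p i \in supported (box (\sum_i b i)).
Proof.
move=> pb; apply: (big_rec2 (fun q c => q \in supported (box c))) => [|i c q _].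
  by rewrite -mpolyX0 supportedX; apply/forallP => j; rewrite mnm0E.
exact: supported_boxM.
Qed.

Lemma supported_box_le b1 b2 p :
  (b1 <= b2)%N -> p \in supported (box b1) -> p \in supported (box b2).
Proof.
move=> b12 /allP pb; apply/allP => m /pb/forallP mb; apply/forallP => j.
exact: leq_trans (mb j) b12.
Qed.

Lemma supported_box_msize p : p \in supported (box (msize p)).
Proof.
apply/allP => m /msize_mdeg_lt mp; apply/forallP => j; apply: leq_trans (ltnW mp).
by rewrite mdegE (bigD1 j) //= leq_addr.
Qed.

Lemma exp_linear_lt (k l a : nat) : (k < l)%N ->
  exists2 N, (0 < N)%N & ((N * a).+1 ^ k < N ^ l)%N.
Proof.
(* For this [N], [(N a + 1)^k <= ((a + 1) N)^k < N^(k + 1) <= N^l]. *)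
move=> kl; pose N := (a.+1 ^ k).+1; exists N => //.
apply: (@leq_trans (N ^ k.+1)); last by rewrite leq_pexp2l.
apply: (@leq_ltn_trans ((a.+1 * N) ^ k)).
  case: (k) => // k'; rewrite leq_exp2r // mulSn mulnC.
  by rewrite -[ltnLHS]add0n ltn_add2r.
by rewrite expnMn expnS ltn_pmul2r ?expn_gt0.
Qed.

(* The N ^ l monomials with exponents < N in l members of the chain span,
   modulo the variables in X, a space of dimension O(N ^ #|~: X|). *)
Lemma prime_flag_length l (P : nat -> {pred {mpoly K[n]}}) f X :
    prime_flag l P f -> (forall j, j \in X -> 'X_j \in P 0%N) ->
  (l <= #|~: X|)%N.
Proof.
move=> flagP XP; rewrite leqNgt; apply/negP => lt_l.
pose a := (\sum_(i < l) msize (f i))%N.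
have [N N0 ltN] := exp_linear_lt a lt_l.
pose F (t : l.-tuple 'I_N) := \prod_(i < l) f i ^+ tnth t i.
(* The columns are the monomials of the box that avoid [X], encoded as functions vanishing on [X];
   there are [(N a + 1)^#|~: X|] of them, fewer than the [N^l] rows. *)
pose M t (g : {g : {ffun 'I_n -> 'I_(N * a).+1} | g \in pffun_on ord0 (~: X) predT}) :=
  (F t)@_[multinom (val g j : nat) | j < n].
have boxF t : F t \in supported (box (N * a)).
  apply: supported_box_le (supported_box_prod _); last first.
    by move=> i; apply/supported_boxX/supported_box_msize.
  by rewrite big_distrr; apply: leq_sum => i _; rewrite leq_mul2r ltnW ?orbT.
have [|c [t ct0] cM] := @row_dependent _ _ M.
  rewrite card_tuple card_ord card_sig.
  by rewrite (eq_card (B := pffun_on ord0 (~: X) predT)) // card_pffun_on card_ord.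
case/eqP: ct0; move: t; apply: (prime_flag_independent flagP).
have idP0 : idealr_closed (P 0%N) by case: (flagP.1 0%N isT).
(* A monomial avoiding [X] has coefficient 0 in the combination: inside the box by the choice of
   [c], outside it because no [F t] reaches it. *)
apply: (variables_in_ideal idP0 XP); apply/supportedP => m.
apply: contraR => nXm; rewrite raddf_sum /=.
have m0 j : j \in X -> m j = 0%N.
  move=> jX; apply/eqP; apply: contraR nXm => mj.
  by apply/existsP; exists j; rewrite jX.
have [/forallP mb|nmb] := boolP (box (N * a) m); last first.
  apply/eqP; rewrite big1 // => t _; rewrite mcoeffZ.
  by have /supportedP/(_ m) := boxF t; case: eqP => [->|_ /(_ isT)]; rewrite ?mulr0 ?(negPf nmb).
pose g : {ffun 'I_n -> 'I_(N * a).+1} := [ffun j => inord (m j)].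
have gX : g \in pffun_on ord0 (~: X) predT.
  apply/pffun_onP; split=> [|_ //]; apply/subsetP => j; rewrite !inE ffunE.
  apply: contra => /m0 ->; apply/eqP/val_inj; rewrite /= inordK //.
rewrite -[X in _ == X](cM (exist _ g gX)); apply/eqP; apply: eq_bigr => t _.
rewrite mcoeffZ; congr (_ * _@_ _); apply/mnmP => j.
by rewrite mnmE ffunE inordK // ltnS mb.
Qed.

Lemma edge_ideal_krull_dim (T : finType) (e : T -> {set 'I_n}) (h s : nat) :
    (0 < s)%N ->
    (forall X, vertex_cover e X -> (h <= #|X|)%N) ->
    (exists2 X, vertex_cover e X & #|X| = h) ->
  quotient_krull_dim (ideal_exp (edge_ideal K e) s) (n - h).
Proof.
move=> s0 hmin [X0 /forallP cov0 X0h]; split; last first.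
  move=> l P [prP JP chP].
  have /boolp.choice[f fP] : forall i, exists p : {mpoly K[n]},
      (i < l)%N -> p \in P i.+1 /\ p \notin P i.
    move=> i; have [/chP[_ [p pS npS]]|nil] := boolP (i < l)%N; first by exists p.
    by exists 0.
  have flagP : prime_flag l P f.
    by split=> // i il; have [sub _] := chP i il; have [] := fP i il.
  (* The smallest prime contains the [s]-th power of every edge monomial, hence a variable of every
     edge, so [X] is a vertex cover. *)
  pose X := [set j | ('X_j : {mpoly K[n]}) \in P 0%N].
  apply: leq_trans (prime_flag_length (X := X) flagP _) _ => [j|]; first by rewrite inE.
  rewrite cardsCs setCK card_ord leq_sub2l // hmin //; apply/forallP => i.
  have : 'X_[mnm_set (e i)] ^+ s \in P 0%N.
    apply: JP; rewrite edge_ideal_exp_supported mpolyXn supportedX.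
    apply/existsP; exists (nseq_tuple s i); rewrite big_nseq.
    suff -> : iter s (+%MM (mnm_set (e i))) 0%MM = (mnm_set (e i) *+ s)%MM.
      exact: lepm_refl.
    by elim: (s) => [|s' IHs]; rewrite ?mulm0n //= IHs mulmS.
  have prP0 := prP 0%N isT.
  move=> /(prime_idealX prP0); rewrite mpolyXE_id => /(prime_ideal_prod prP0)[j].
  rewrite mnmE; case: (boolP (j \in e i)) => [je|_]; last first.
    by rewrite expr0; case: prP0 => -[_ /negPf ->].
  by rewrite expr1 => jP; apply/pred0Pn; exists j; rewrite /= je inE.
(* A chain of length [n - h]: the minimum cover [X0] is enlarged by one vertex at a time. *)
pose Y i := X0 :|: [set j in take i (enum (~: X0))].
exists (fun i => supported (meets (Y i))); split=> [i _|p|i ilt].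
- exact: meets_prime.
- rewrite edge_ideal_exp_supported => /supportedP Jp; apply/supportedP => m.
  move=> /Jp/existsP[t /mnm_lepP tm].
  case: s s0 {Jp} t tm => // s _ t tm.
  have /pred0Pn[j /andP[/= je jX]] := cov0 (thead t).
  apply/existsP; exists j; rewrite inE jX /= -lt0n; apply: leq_trans (tm j).
  by rewrite (tuple_eta t) big_cons mnmDE mnmE je.
have ilt' : (i < size (enum (~: X0)))%N by rewrite -cardE cardsCs setCK card_ord X0h.
have [j0 jE] : exists j0, take i.+1 (enum (~: X0)) = rcons (take i (enum (~: X0))) j0.
  case: (enum _) ilt' => // x r ir; exists (nth x (x :: r) i).
  exact: take_nth.
have subY : Y i \subset Y i.+1.
  apply: setUS; apply/subsetP => j; rewrite !inE jE mem_rcons inE => ->.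
  by rewrite orbT.
split=> [p /supportedP Yp|].
  apply/supportedP => m /Yp/existsP[j /andP[jY mj]].
  by apply/existsP; exists j; rewrite (subsetP subY).
exists 'X_j0; rewrite supportedX.
  apply/existsP; exists j0; rewrite mnm1E eqxx andbT.
  by rewrite !inE jE mem_rcons mem_head orbT.
apply/existsP => -[j /andP[jY]]; rewrite mnm1E; have [eqj _|//] := eqVneq j0 j.
move: jY; rewrite -{}eqj !inE.
have : uniq (take i.+1 (enum (~: X0))) by rewrite take_uniq ?enum_uniq.
rewrite {1}jE rcons_uniq => /andP[/negPf -> _]; rewrite orbF => jX.
have : j0 \in take i.+1 (enum (~: X0)) by rewrite jE mem_rcons mem_head.
by move/mem_take; rewrite mem_enum inE jX.
Qed.

End MonomialPrimes.

(** * Hilbert series *)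

Section TruncatedPolynomials.
Implicit Types p q : {poly int}.

(** Congruence modulo ['X^(a.+1)]: power series are handled through polynomial truncations. *)
Definition eq_upto (a : nat) p q := forall i, (i <= a)%N -> p`_i = q`_i.

Lemma eq_uptoM a p p' q q' :
  eq_upto a p p' -> eq_upto a q q' -> eq_upto a (p * q) (p' * q').
Proof.
move=> pp qq i ia; rewrite !coefM; apply: eq_bigr => j _.
by rewrite pp ?qq // ?(leq_trans (leq_subr _ _)) // (leq_trans _ ia) // -ltnS.
Qed.

(** The product telescopes to ['X^s - 'X^b], and [b] exceeds [a]. *)
Lemma eq_upto_geometric a s b : (a + s < b)%N ->
  eq_upto a ((1 - 'X) * \sum_(i < b | (s <= i)%N) 'X^i) 'X^s.
Proof.
move=> ab i ia; have lesb : (s <= b)%N by rewrite (leq_trans _ (ltnW ab)) ?leq_addl.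
rewrite -(big_mkord (fun i => (s <= i)%N) (fun i => 'X^i)).
rewrite -(big_nat_widenl s 0 b predT) // mulr_sumr.
rewrite (eq_bigr (fun j => - ('X^(j.+1) - 'X^j))) => [|j _]; last first.
  by rewrite opprB mulrBl mul1r -exprS.
rewrite sumrN telescope_sumr // opprB coefB !coefXn.
by rewrite [i == b]ltn_eqF ?subr0 // (leq_ltn_trans _ ab) // (leq_trans ia) ?leq_addr.
Qed.

End TruncatedPolynomials.

(** * The Hilbert series as a sum over cells *)

Section StandardMonomials.
Variables (n : nat) (A : pred 'X_{1..n}).

Definition mnm_ffun b (f : {ffun 'I_n -> 'I_b}) : 'X_{1..n} :=
  [multinom (f j : nat) | j < n].

Lemma mnm_ffun_inj b : injective (@mnm_ffun b).
Proof.
move=> f g /mnmP fg; apply/ffunP => j; apply: val_inj.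
by have := fg j; rewrite !mnmE.
Qed.

(** The bound [b] only serves finiteness: once [a < b], every monomial of degree [a] fits. *)
Definition standard b a :=
  [set f : {ffun 'I_n -> 'I_b} | (mdeg (mnm_ffun f) == a) && ~~ A (mnm_ffun f)].

Definition standard_mnms b a := [seq mnm_ffun f | f <- enum (standard b a)].

Lemma standard_mnms_uniq b a : uniq (standard_mnms b a).
Proof. by rewrite map_inj_uniq ?enum_uniq //; apply: mnm_ffun_inj. Qed.

Lemma mem_standard_mnms b a m : (a < b)%N ->
  (m \in standard_mnms b a) = (mdeg m == a) && ~~ A m.
Proof.
move=> ab; apply/mapP/idP => [[f] | mP]; first by rewrite mem_enum inE => fP ->.
have mb j : (m j < b)%N.
  case/andP: mP => /eqP <- _ in ab *; apply: leq_ltn_trans ab.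
  by rewrite mdegE (bigD1 j) //= leq_addr.
have mE : m = mnm_ffun [ffun j => Ordinal (mb j)].
  by apply/mnmP => j; rewrite mnmE ffunE.
by exists [ffun j => Ordinal (mb j)]; rewrite // mem_enum inE -mE.
Qed.

Lemma card_standard b a : (a < b)%N -> #|standard b a| = size (standard_mnms a.+1 a).
Proof.
move=> ab; rewrite cardE -(size_map (@mnm_ffun b)).
apply/perm_size/uniq_perm; try exact: standard_mnms_uniq.
by move=> m; rewrite !mem_standard_mnms.
Qed.

Variables (s D : nat).
Hypothesis A_trunc : forall m, A m = A [multinom minn (m j) s | j < n].

(** In the cell of [v], a coordinate equal to [s] stands for all exponents from [s] on. *)
Definition free_dirs (v : {ffun 'I_n -> 'I_s.+1}) := [set j | (v j : nat) == s].

Hypothesis free_le : forall v, ~~ A (mnm_ffun v) -> (#|free_dirs v| <= D)%N.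

(** The sum of the cell series, brought over the common denominator [(1 - 'X)^D]. *)
Definition series_numerator : {poly int} :=
  \sum_(v : {ffun 'I_n -> 'I_s.+1} | ~~ A (mnm_ffun v))
    (1 - 'X) ^+ (D - #|free_dirs v|) * \prod_j 'X^(v j).

Lemma series_numerator1 :
  series_numerator.[1] =
  #|[set v : {ffun 'I_n -> 'I_s.+1}
        | ~~ A (mnm_ffun v) & (D <= #|free_dirs v|)%N]|%:Z.
Proof.
rewrite horner_sum -sum1_card -natz natr_sum.
under [RHS]eq_bigl do rewrite inE.
rewrite big_mkcondr /=; apply: eq_bigr => v nAv.
rewrite hornerM horner_exp !hornerE subrr expr0n subn_eq0.
rewrite horner_prod big1 ?mulr1 => [|j _]; last by rewrite hornerXn expr1n.
by case: leqP.
Qed.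

Definition truncate b (f : {ffun 'I_n -> 'I_b}) : {ffun 'I_n -> 'I_s.+1} :=
  [ffun j => inord (minn (f j) s)].

Lemma truncateP b (f : {ffun 'I_n -> 'I_b}) : A (mnm_ffun (truncate f)) = A (mnm_ffun f).
Proof.
rewrite [RHS]A_trunc; congr A; apply/mnmP => j.
by rewrite !mnmE ffunE inordK // ltnS geq_minr.
Qed.

(** A cell is a product of one-dimensional sets, so its generating polynomial factors over the
    coordinates. *)
Lemma cell_series b (v : {ffun 'I_n -> 'I_s.+1}) :
  \sum_(f : {ffun 'I_n -> 'I_b} | truncate f == v) ('X^(mdeg (mnm_ffun f)) : {poly int})
  = \prod_j \sum_(x < b | minn x s == v j) 'X^x.
Proof.
rewrite bigA_distr_big_dep; apply: eq_big => [f|f _].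
  apply/eqP/familyP => [<- j|fv]; first by rewrite unfold_in ffunE inordK // ltnS geq_minr.
  apply/ffunP => j; apply/val_inj; rewrite ffunE /= inordK ?ltnS ?geq_minr //.
  exact/eqP/fv.
by rewrite mdegE -prodrXr; apply: eq_bigr => j _; rewrite mnmE.
Qed.

(** Each free coordinate uses up one factor [1 - 'X] to turn its geometric sum into ['X^s]; every
    other coordinate contributes a single monomial. *)
Lemma eq_upto_cell a b (v : {ffun 'I_n -> 'I_s.+1}) :
    (a + s < b)%N -> (#|free_dirs v| <= D)%N ->
  eq_upto a ((1 - 'X) ^+ D * \prod_j \sum_(x < b | minn x s == v j) 'X^x)
    ((1 - 'X) ^+ (D - #|free_dirs v|) * \prod_j 'X^(v j)).
Proof.
move=> ab le_vD; rewrite -{1}(subnK le_vD) exprD -mulrA; apply: eq_uptoM => [//|].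
rewrite -prodr_const big_mkcond -big_split /=.
apply: (big_ind2 (eq_upto a)) => [//|p p' q q'|j _]; first exact: eq_uptoM.
rewrite inE; have [vjs|vjs] := eqVneq (v j : nat) s.
  rewrite vjs (eq_bigl (fun x : 'I_b => (s <= x)%N)) => [|x]; last first.
    by rewrite (sameP minn_idPr eqP).
  exact: eq_upto_geometric.
have ltvs : (v j < s)%N by rewrite ltn_neqAle vjs -ltnS ltn_ord.
have ltvb : (v j < b)%N by rewrite (ltn_trans ltvs) // (leq_ltn_trans _ ab) ?leq_addl.
rewrite mul1r (big_pred1 (Ordinal ltvb)) => [//|x] /=.
rewrite -val_eqE /=; case: (leqP x s) => [//|sx].
by rewrite eq_sym (negPf vjs) gtn_eqF // (ltn_trans ltvs).
Qed.

Lemma standard_hilbert_series :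
  hilbert_series_eq (fun a => size (standard_mnms a.+1 a)) series_numerator D.
Proof.
(* This box contains all monomials of degree at most [a] and is large enough for
   [eq_upto_geometric]. *)
move=> a; pose b := (a + s).+1.
pose p : {poly int} :=
  \sum_(f : {ffun 'I_n -> 'I_b} | ~~ A (mnm_ffun f)) 'X^(mdeg (mnm_ffun f)).
have coefp i : (i <= a)%N -> p`_i = (size (standard_mnms i.+1 i))%:Z.
  move=> ia; rewrite -(@card_standard b) => [|]; last first.
    by rewrite ltnS (leq_trans ia) ?leq_addr.
  rewrite -sum1_card -natz natr_sum coef_sum.
  rewrite [RHS](eq_bigl (fun f => ~~ A (mnm_ffun f) && (mdeg (mnm_ffun f) == i))).
    rewrite [RHS]big_mkcondr; apply: eq_bigr => f _.
    by rewrite coefXn eq_sym; case: eqP.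
  by move=> f; rewrite inE andbC.
transitivity (((1 - 'X) ^+ D * p)`_a).
  by rewrite coefM; apply: eq_bigr => i _; rewrite coefp // leq_subr.
rewrite /p (partition_big (@truncate b) (fun v => ~~ A (mnm_ffun v))) => [|f]; last first.
  by rewrite truncateP.
rewrite mulr_sumr !coef_sum; apply: eq_bigr => v nAv.
rewrite (eq_bigl (fun f => truncate f == v)) => [|f]; last first.
  have [eqv|_] := eqVneq (truncate f) v; last by rewrite andbF.
  by rewrite -truncateP eqv nAv.
rewrite cell_series; exact: eq_upto_cell (ltnSn _) (free_le nAv) _ (leqnn a).
Qed.

End StandardMonomials.

(** * Multiplicity *)

Section BoundedSum.
Local Open Scope nat_scope.
Variables (n s : nat) (X : {set 'I_n}).

Let Xlist : #|X|.-tuple 'I_n := [tuple of enum X].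

(** Coordinates outside [X] are frozen at the top value, so [v] amounts to a tuple of [#|X|]
    naturals with sum at most [s], as counted by [card_partial_ord_partitions]. *)
Lemma card_bounded_sum :
  #|[set v : {ffun 'I_n -> 'I_s.+2} |
      [forall (j | j \notin X), v j == s.+1 :> nat] && (\sum_(j in X) v j <= s)]|
  = 'C(#|X| + s, #|X|).
Proof.
rewrite -card_partial_ord_partitions; set V := [set v | _]; set W := [set t | _].
pose f (v : {ffun 'I_n -> 'I_s.+2}) : #|X|.-tuple 'I_s.+1 :=
  [tuple of map (fun j => inord (v j)) Xlist].
have ltv v j : v \in V -> j \in X -> v j < s.+1.
  rewrite inE => /andP[_]; rewrite ltnS => le_s jX; apply: leq_trans le_s.
  by rewrite (bigD1 j) //= leq_addr.
have sumf v : v \in V -> \sum_(i <- f v) i = \sum_(j in X) v j.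
  move=> vV; rewrite big_map /= big_enum /=.
  by apply: eq_bigr => j jX; rewrite inordK ?ltv.
have finj : {in V &, injective f}.
  move=> v w vV wV /(congr1 val) /= /eq_in_map fvw; apply/ffunP => j.
  have [jX|nX] := boolP (j \in X).
    have := fvw j; rewrite mem_enum => /(_ jX) /(congr1 val).
    by rewrite /= !inordK ?ltv // => /val_inj.
  apply/val_inj; move: vV wV; rewrite !inE => /andP[/forallP/(_ j) + _].
  by rewrite nX => /eqP /= -> /andP[/forallP/(_ j) + _]; rewrite nX => /eqP /= ->.
rewrite -(card_in_imset finj); apply: eq_card => t; apply/imsetP/idP.
  by case=> v vV ->; rewrite inE sumf //; move: vV; rewrite inE => /andP[].
rewrite inE => tW.
pose v : {ffun 'I_n -> 'I_s.+2} := [ffun j =>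
  if j \in X then inord (nth ord0 t (index j Xlist)) else ord_max].
have vX j : j \in X -> v j = nth ord0 t (index j Xlist) :> nat.
  by move=> jX; rewrite ffunE jX inordK // ltnS ltnW.
have tE : t = f v.
  apply/eq_from_tnth => i; rewrite tnth_map; apply/val_inj => /=.
  have iX : tnth Xlist i \in X by rewrite -mem_enum mem_tnth.
  rewrite vX // index_uniq ?enum_uniq -?cardE // (tnth_nth ord0) -?tnth_nth.
  by rewrite inordK.
exists v => //; rewrite inE; apply/andP; split.
  by apply/forallP => j; apply/implyP => /negPf nX; rewrite ffunE nX.
apply: leq_trans tW; rewrite tE big_map /= big_enum /=.
by apply: leq_sum => j jX; rewrite inordK // vX.
Qed.

End BoundedSum.

(** * Cells of maximal dimension and minimum vertex covers *)

Section EdgeIdealMultiplicity.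
Variables (n : nat) (T : finType) (e : T -> {set 'I_n}).
Implicit Types (m : 'X_{1..n}) (X : {set 'I_n}).

Lemma mnm_sum_edgesE (t : seq T) j :
  (\sum_(i <- t) mnm_set (e i))%MM j = (\sum_(i <- t) (j \in e i))%N.
Proof. by rewrite mnm_sumE; apply: eq_bigr => i _; rewrite mnmE. Qed.

Lemma mnm_sum_edges_le (t : seq T) j :
  ((\sum_(i <- t) mnm_set (e i))%MM j <= size t)%N.
Proof.
rewrite mnm_sum_edgesE -sum1_size; apply: leq_sum => i _.
by case: (_ \in _).
Qed.

(** A product of [s] squarefree monomials has all exponents at most [s]. *)
Lemma power_gens_trunc s m :
  power_gens e s m = power_gens e s [multinom minn (m j) s | j < n].
Proof.
apply: eq_existsb => t; apply/mnm_lepP/mnm_lepP => tm j.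
  by rewrite mnmE leq_min tm -[leqRHS](size_tuple t) mnm_sum_edges_le.
by have := tm j; rewrite mnmE leq_min => /andP[].
Qed.

Variables (h s : nat).
Hypothesis s0 : (0 < s)%N.
Hypothesis hmin : forall X, vertex_cover e X -> (h <= #|X|)%N.

(** The [s]-th power of this one edge monomial divides the monomial of [v]. *)
Lemma power_gens_free (v : {ffun 'I_n -> 'I_s.+1}) i :
  e i \subset free_dirs v -> power_gens e s (mnm_ffun v).
Proof.
move=> ev; apply/existsP; exists (nseq_tuple s i); apply/mnm_lepP => j.
rewrite mnm_sum_edgesE big_nseq iter_addn_0 mnmE mulnC.
have [/(subsetP ev)|_] := boolP (j \in e i); last by rewrite muln0.
by rewrite inE muln1 => /eqP ->.
Qed.

Lemma standard_vertex_cover (v : {ffun 'I_n -> 'I_s.+1}) :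
  ~~ power_gens e s (mnm_ffun v) -> vertex_cover e (~: free_dirs v).
Proof.
move=> nv; apply/forallP => i; rewrite disjoints_subset setCK.
by apply: contra nv; apply: power_gens_free.
Qed.

(** By minimality [X :\ j] misses some edge, which [X] can then meet only in [j]. *)
Lemma private_edge X j :
  vertex_cover e X -> #|X| = h -> j \in X -> exists i, e i :&: X = [set j].
Proof.
move=> /forallP covX Xh jX.
have /forallPn[i /negPn] : ~~ vertex_cover e (X :\ j).
  by apply/negP => /hmin; rewrite -Xh (cardsD1 j X) jX ltnn.
rewrite disjoints_subset => /subsetP eX.
have eXj k : k \in e i -> k \in X -> k = j.
  by move=> /eX; rewrite !inE => /nandP[/negPn/eqP|/negPf ->].
have /pred0Pn[k /andP[/= ke kX]] := covX i; have kj := eXj k ke kX.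
rewrite kj in ke; exists i => //; apply/setP => l; rewrite !inE.
by apply/andP/eqP => [[le lX]|->]; [apply: eXj | rewrite ke].
Qed.

(** Each of [s] edges meets [X], so together they use at least [s] units of exponent on [X].
    Conversely, private edges spend exactly one unit on [X] each. *)
Lemma standard_max_free (v : {ffun 'I_n -> 'I_s.+1}) X :
    vertex_cover e X -> #|X| = h ->
    (forall j, j \notin X -> v j = s :> nat) ->
  power_gens e s (mnm_ffun v) = (s <= \sum_(j in X) v j)%N.
Proof.
move=> covX Xh vX; apply/idP/idP => [/existsP[t /mnm_lepP tv]|sv].
  apply: (@leq_trans (\sum_(j in X) (\sum_(i <- t) mnm_set (e i))%MM j)).
    under eq_bigr do rewrite mnm_sum_edgesE.
    rewrite exchange_big /= -[leqLHS](size_tuple t) -sum1_size.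
    apply: leq_sum => i _; have /forallP/(_ i)/pred0Pn[j /andP[/= je jX]] := covX.
    by rewrite (bigD1 j) //= je.
  by apply: leq_sum => j _; apply: leq_trans (tv j) _; rewrite mnmE.
(* As [s] is positive, [X] is nonempty; this yields an edge [i0], the default value of the choice
   function [c] outside [X]. *)
have /existsP[j0 j0X] : [exists j, j \in X].
  apply: contraTT sv => /existsPn X0; rewrite big1 -?ltnNge // => j jX.
  by case/negP: (X0 j).
have [i0 _] := private_edge covX Xh j0X.
have /boolp.choice[c cP] : forall j, exists i, j \in X -> e i :&: X = [set j].
  move=> j; have [/(private_edge covX Xh)[i eiX]|_] := boolP (j \in X); first by exists i.
  by exists i0.
(* Each [j] in [X] gets [v j] copies of its private edge; the first [s] edges of the list are kept.
   Outside [X] the exponent [s] accommodates any [s] edges. *)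
pose t := flatten [seq nseq (v j) (c j) | j <- enum X].
have sumt (F : T -> nat) : (\sum_(i <- t) F i = \sum_(j in X) v j * F (c j))%N.
  rewrite big_flatten big_map big_enum /=; apply: eq_bigr => j _.
  by rewrite big_nseq iter_addn_0 mulnC.
have size_t : size (take s t) == s.
  apply/eqP/size_takel; rewrite -sum1_size sumt.
  by under eq_bigr do rewrite muln1.
apply/existsP; exists (Tuple size_t); apply/mnm_lepP => j /=; rewrite mnmE.
have [jX|/vX ->] := boolP (j \in X); last first.
  by rewrite -[leqRHS](eqP size_t) mnm_sum_edges_le.
rewrite mnm_sum_edgesE; apply: (@leq_trans (\sum_(i <- t) (j \in e i))).
  by rewrite -[in leqRHS](cat_take_drop s t) big_cat leq_addr.
rewrite sumt (bigD1 j) //= big1 ?addn0 => [|k /andP[kX kj]].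
  by rewrite -[leqRHS]muln1 leq_mul2l leq_b1 orbT.
have : j \notin e (c k) :&: X by rewrite cP // inE eq_sym.
by rewrite inE jX andbT => /negPf ->; rewrite muln0.
Qed.

End EdgeIdealMultiplicity.

Lemma card_standard_max_free n (T : finType) (e : T -> {set 'I_n}) (h s : nat) :
    (forall X, vertex_cover e X -> (h <= #|X|)%N) ->
  #|[set v : {ffun 'I_n -> 'I_s.+2} |
      ~~ power_gens e s.+1 (mnm_ffun v) & (n - h <= #|free_dirs v|)%N]|
  = (#|[set X | vertex_cover e X & #|X| == h]| * 'C(h + s, h))%N.
Proof.
move=> hmin; pose Xs := [set X | vertex_cover e X & #|X| == h].
rewrite -sum1_card.
(* The vertices that are not free form a cover with at most [h], hence exactly [h], elements. *)
rewrite (partition_big (fun v => ~: free_dirs v) (mem Xs)) /= => [|v]; last first.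
  rewrite !inE => /andP[/standard_vertex_cover covv]; rewrite covv eqn_leq hmin //.
  by rewrite andbT cardsCs setCK card_ord !leq_subLR addnC.
rewrite -sum_nat_const; apply: eq_bigr => X; rewrite inE => /andP[covX /eqP Xh].
rewrite -{2 3}Xh -card_bounded_sum -sum1_card; apply: eq_bigl => v; rewrite !inE.
apply/andP/andP => [[/andP[nv _] /eqP vX]|[/forallP vX le_s]].
  have vX' j : j \notin X -> v j = s.+1 :> nat.
    by rewrite -vX !inE negbK => /eqP.
  rewrite -ltnS ltnNge -(standard_max_free _ hmin covX Xh vX') //; split=> //.
  by apply/forallP => j; apply/implyP => /vX' ->.
have vX' j : j \notin X -> v j = s.+1 :> nat.
  by move=> jX; have := vX j; rewrite jX => /eqP.
have eX : ~: free_dirs v = X.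
  apply/setP => j; rewrite !inE; have [jX|/vX' ->] := boolP (j \in X).
    by rewrite ltn_eqF // ltnS (leq_trans _ le_s) // (bigD1 j) //= leq_addr.
  by rewrite eqxx.
rewrite eX eqxx (standard_max_free _ hmin covX Xh vX') // -ltnNge ltnS le_s.
split=> //=.
by rewrite -[free_dirs v]setCK eX cardsCs setCK card_ord Xh.
Qed.

Theorem edge_ideal_multiplicity (K : fieldType) n (T : finType)
    (e : T -> {set 'I_n}) (h s : nat) :
    (forall X, vertex_cover e X -> (h <= #|X|)%N) ->
    (exists2 X, vertex_cover e X & #|X| = h) ->
  multiplicity (ideal_exp (edge_ideal K e) s.+1)
    (#|[set X | vertex_cover e X & #|X| == h]| * 'C(h + s, h))%:Z.
Proof.
move=> hmin hex; pose A := power_gens e s.+1.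
have numE : (series_numerator A s.+1 (n - h)).[1]
    = (#|[set X | vertex_cover e X & #|X| == h]| * 'C(h + s, h))%:Z.
  by rewrite series_numerator1 card_standard_max_free.
exists (n - h)%N, (fun a => size (standard_mnms A a.+1 a)).
exists (series_numerator A s.+1 (n - h)); split.
- exact: edge_ideal_krull_dim.
- move=> a; apply: (@hilbert_value_supported _ _ _ A).
  + exact: edge_ideal_exp_supported.
  + exact: standard_mnms_uniq.
  + by move=> m; apply: mem_standard_mnms.
- apply: standard_hilbert_series => [m|v /standard_vertex_cover/hmin].
    exact: power_gens_trunc.
  have leDn : (#|free_dirs v| <= n)%N by rewrite -[leqRHS]card_ord max_card.
  by rewrite cardsCs setCK card_ord => /(leq_sub2l n); rewrite subKn.
- rewrite numE ltz_nat muln_gt0 bin_gt0 leq_addr andbT.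
  by case: hex => X covX Xh; apply/card_gt0P; exists X; rewrite inE covX Xh /=.
by rewrite numE.
Qed.

(** * Minimum vertex covers of cycles *)

Section CyclicCovers.
Local Open Scope nat_scope.
Variables (n d : nat).
Hypotheses (d_gt0 : 0 < d) (le_dn : d <= n).

(** A window of [d] consecutive residues misses [c] only if it fits strictly inside a gap; the last
    inequality is the gap across 0. *)
Lemma cyclic_cover_gaps (c : seq nat) :
    sorted ltn c -> (forall x, x \in c -> x < n) -> 0 < size c ->
  (forall i, i < n -> exists2 l, l < d & (i + l) %% n \in c) <->
  (forall j, j.+1 < size c -> nth 0 c j.+1 <= nth 0 c j + d) /\
  nth 0 c 0 + n <= nth 0 c (size c).-1 + d.
Proof.
move=> c_sorted c_lt c_gt0.
have c_mono p q : p < q -> q < size c -> nth 0 c p < nth 0 c q.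
  move=> pq qc; apply: (sorted_ltn_nth ltn_trans) => //.
  by rewrite inE (ltn_trans pq).
have c_le p q : p <= q -> q < size c -> nth 0 c p <= nth 0 c q.
  by rewrite leq_eqVlt => /orP[/eqP-> //|pq qc]; apply/ltnW/c_mono.
have c_bnd q : q < size c -> nth 0 c q < n by move=> qc; apply/c_lt/mem_nth.
have memc (x : nat) : x \in c -> exists2 q, q < size c & nth 0 c q = x.
  by move/(nthP 0).
have ltk : (size c).-1 < size c by lia.
have c_last := c_bnd _ ltk.
split=> [cov|[gaps wrap]].
  split=> [j jc|]; rewrite leqNgt; apply/negP => far.
    have cj := c_bnd _ jc.
    have [|l ld] := cov (nth 0 c j).+1; first by lia.
    rewrite modn_small; last by lia.
    case/memc => q qc qE; have [qj|jq] := leqP q j.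
      by have := c_le q j qj (ltnW jc); lia.
    by have := c_le j.+1 q jq qc; lia.
  (* The offending window starts just after the last element, which means at 0 if that element is
     [n - 1]. *)
  have [lastlt|lastn] := ltnP (nth 0 c (size c).-1).+1 n.
    have [l ld] := cov _ lastlt.
    have [lt_n|le_n] := ltnP ((nth 0 c (size c).-1).+1 + l) n.
      rewrite modn_small // => /memc[q qc qE].
      have qlast : q <= (size c).-1 by lia.
      by have := c_le q _ qlast ltk; lia.
    rewrite -[X in X %% n](subnK le_n) modnDr modn_small; last by lia.
    by case/memc => q qc qE; have := c_le 0 q (leq0n _) qc; lia.
  have [|l ld] := cov 0; first by lia.
  rewrite add0n modn_small; last by lia.
  by case/memc => q qc qE; have := c_le 0 q (leq0n _) qc; lia.
(* The window from [i] catches the first element of [c] at or after [i], or else the least element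
   of [c] after wrapping around. *)
move=> i i_lt; have [le_i|lt_i] := leqP i (nth 0 c (size c).-1); last first.
  exists (nth 0 c 0 + n - i); first by lia.
  have -> : i + (nth 0 c 0 + n - i) = nth 0 c 0 + n by lia.
  by rewrite modnDr modn_small ?c_bnd // mem_nth.
have exj : exists j, (j < size c) && (i <= nth 0 c j).
  by exists (size c).-1; rewrite ltk.
case: (ex_minnP exj) => j /andP[jc le_ij] jmin.
exists (nth 0 c j - i); last first.
  by rewrite subnKC // modn_small ?c_bnd // mem_nth.
case: j jc le_ij jmin => [|j] jc le_ij jmin; first by lia.
have := gaps j jc; have [le_j _|] := leqP i (nth 0 c j); last by lia.
by have := jmin j; rewrite (ltnW jc) le_j ltnn => /(_ isT).
Qed.

Definition cycle_edge (i : 'I_n) : {set 'I_n} :=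
  [set iter (l : 'I_d) (@ordS n) i | l in predT].

Lemma val_iter_ordS l (i : 'I_n) : iter l (@ordS n) i = (i + l) %% n :> nat.
Proof.
elim: l => [|l IHl] /=; first by rewrite addn0 modn_small.
by rewrite IHl -addn1 modnDml addn1 addnS.
Qed.

Lemma mem_cycle_edge (i j : 'I_n) :
  reflect (exists2 l, l < d & (i + l) %% n = j) (j \in cycle_edge i).
Proof.
apply: (iffP imsetP) => [[l _ ->]|[l ld ilj]].
  by exists l; rewrite ?val_iter_ordS.
by exists (Ordinal ld) => //; apply: val_inj; rewrite /= val_iter_ordS.
Qed.

Lemma cycle_vertex_coverP (X : {set 'I_n}) :
  reflect (forall i, i < n ->
             exists2 l, l < d & (i + l) %% n \in [seq val x | x <- enum X])
          (vertex_cover cycle_edge X).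
Proof.
apply: (iffP forallP) => [cov i i_lt|cov i].
  have /pred0Pn[j /andP[/= /mem_cycle_edge[l ld ilj] jX]] := cov (Ordinal i_lt).
  by exists l => //; rewrite ilj map_f ?mem_enum.
have [l ld /mapP[j jX ilj]] := cov i (ltn_ord i).
apply/pred0Pn; exists j; apply/andP; split; last by move: jX; rewrite mem_enum.
by apply/mem_cycle_edge; exists l.
Qed.

Lemma sorted_enum_val (X : {set 'I_n}) : sorted ltn [seq val x | x <- enum X].
Proof.
have -> : [seq val x | x <- enum X] = [seq x <- iota 0 n | x \in [seq val x | x <- enum X]].
  rewrite -val_enum_ord filter_map {1}/enum_mem -enumT; congr map.
  by apply: eq_filter => x; rewrite /= (mem_map val_inj) mem_enum.
exact: (sorted_filter ltn_trans) (iota_ltn_sorted 0 n).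
Qed.

Lemma cycle_vertex_cover_gapsP (X : {set 'I_n}) (c : seq nat) :
    [seq val x | x <- enum X] = c -> 0 < size c ->
  vertex_cover cycle_edge X <->
  (forall j, j.+1 < size c -> nth 0 c j.+1 <= nth 0 c j + d) /\
  nth 0 c 0 + n <= nth 0 c (size c).-1 + d.
Proof.
move=> cX c_gt0; rewrite -cyclic_cover_gaps //.
- by rewrite -cX; split=> /cycle_vertex_coverP.
- by rewrite -cX sorted_enum_val.
by move=> x; rewrite -cX => /mapP[i _ ->]; apply: ltn_ord.
Qed.

(** The [#|X|] gaps around the cycle add up to [n], and each is at most [d]. *)
Lemma cycle_vertex_cover_size (X : {set 'I_n}) :
  vertex_cover cycle_edge X -> n <= #|X| * d.
Proof.
move=> covX; pose c := [seq val x | x <- enum X].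
have sizec : size c = #|X| by rewrite size_map -cardE.
have c_gt0 : 0 < size c.
  have /cycle_vertex_coverP/(_ 0 (leq_trans d_gt0 le_dn)) := covX.
  by case=> l _; rewrite -/c; case: (c).
have [gaps wrap] := (cycle_vertex_cover_gapsP (erefl c) c_gt0).1 covX.
have c_le j : j < size c -> nth 0 c j <= nth 0 c 0 + j * d.
  elim: j => [|j IHj] jc; first by lia.
  have := gaps j jc; have := IHj (ltnW jc); rewrite mulSn; lia.
have := c_le (size c).-1; rewrite -sizec; case: (size c) c_gt0 wrap => // q _ /=.
rewrite mulSn => wrap /(_ (ltnSn q)); lia.
Qed.

End CyclicCovers.

(** * Enumeration of the minimum covers by their deficits *)

Section MinimumCycleCovers.
Local Open Scope nat_scope.

Lemma sorted_leq_rcons (s : seq nat) x :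
  sorted leq (rcons s x) = sorted leq s && (last 0 s <= x).
Proof.
have path0 t : path leq 0 t = sorted leq t by case: t.
by rewrite -!path0 rcons_path.
Qed.

Lemma card_sorted_tuples_top (d k m r : nat) : d = r + m ->
  #|[set p : 'I_d * k.-tuple 'I_m.+1 |
      sorted leq (map val p.2) && (r + last 0 (map val p.2) <= p.1)]|
  = 'C(k + m, k.+1).
Proof.
move=> dE; have d_lt (a : 'I_d) : a < r + m by rewrite -dE.
(* For [m = 0] both sides vanish; otherwise the appended entry [p.1 - r] has a nonempty ordinal type
   to live in. *)
case: m dE d_lt => [|m] dE d_lt; set Q := [set p | _].
  rewrite addn0 bin_small //; apply: eq_card0 => p; rewrite inE; apply/negP.
  by case/andP=> _; rewrite leqNgt (leq_trans (d_lt p.1)) // leq_add2l.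
rewrite -addSnnS -card_sorted_tuples.
have QE p : p \in Q -> r <= p.1 /\ sorted leq (rcons (map val p.2) (p.1 - r)).
  rewrite inE sorted_leq_rcons => /andP[-> lastp].
  have rp := leq_trans (leq_addr _ _) lastp.
  by rewrite leq_subRL.
pose f (p : 'I_d * k.-tuple 'I_m.+2) : k.+1.-tuple 'I_m.+1 :=
  [tuple of rcons (map (fun x : 'I_m.+2 => inord x) p.2) (inord (p.1 - r))].
(* All entries are bounded by the last one, [p.1 - r], which is below [m.+1]; hence [inord] changes
   no value. *)
have fE p : p \in Q -> map val (f p) = rcons (map val p.2) (p.1 - r).
  move=> pQ; have [rp] := QE p pQ; rewrite (sorted_pairwise leq_trans) pairwise_rcons.
  case/andP=> /allP b_le _; have p_lt : p.1 - r < m.+1.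
    by have := d_lt p.1; lia.
  rewrite /= map_rcons -map_comp inordK //; congr rcons; apply/eq_in_map => x xp.
  by rewrite /= inordK // (leq_ltn_trans _ p_lt) // b_le // map_f.
have f_inj : {in Q &, injective f}.
  move=> p q pQ qQ /(congr1 (fun t : k.+1.-tuple _ => map val t)); rewrite !fE //.
  have [rp _] := QE p pQ; have [rq _] := QE q qQ.
  move=> /rcons_inj[/(inj_map val_inj) eq2 eq1].
  case: p q eq1 eq2 rp rq {pQ qQ} => [a b] [a' b'] /= eq1 eq2 rp rq.
  by congr (_, _); apply: val_inj => //=; lia.
rewrite -(card_in_imset f_inj); apply: eq_card => t; apply/imsetP/idP.
  by case=> p pQ ->; rewrite inE fE //; case: (QE p pQ).
rewrite inE; case/tupleP: t => x t t_sorted.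
have a_lt : r + last x t < d by rewrite [ltnRHS]dE ltn_add2l ltn_ord.
pose b : k.-tuple 'I_m.+2 := [tuple of map (widen_ord (leqnSn _)) (belast x t)].
have bE : map val b = map val (belast x t) by rewrite -map_comp.
have pQ : (Ordinal a_lt, b) \in Q.
  rewrite inE /= -/b leq_add2l bE -[_ <= _]/(_ <= val (last x t)).
  by rewrite -sorted_leq_rcons -map_rcons -lastI.
exists (Ordinal a_lt, b) => //; apply/val_inj/(inj_map val_inj).
by rewrite fE // bE /= addKn -[nat_of_ord _]/(val _) -map_rcons -lastI.
Qed.

Variables (d k r : nat).
Hypotheses (r_gt0 : 0 < r) (le_rd : r <= d) (k_gt0 : 0 < k).
Let m := d - r.
Let n := k * d + r.

(** Here [p.1] is the least vertex [c_0] and [p.2] lists [b_1, ..., b_k]; the strict inequality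
    expresses [c_k < n]. *)
Definition deficit_data :=
  [set p : 'I_d * k.-tuple 'I_m.+1 |
    sorted leq (map val p.2) && (p.1 < r + last 0 (map val p.2))].

(** The prefixed 0 is the deficit [b_0] of [c_0] itself. *)
Definition cover_seq (p : 'I_d * k.-tuple 'I_m.+1) : seq nat :=
  mkseq (fun j => p.1 + j * d - nth 0 (0 :: map val p.2) j) k.+1.

Definition cover_of p : {set 'I_n} := [set i : 'I_n | (i : nat) \in cover_seq p].

Lemma deficit_le (p : 'I_d * k.-tuple 'I_m.+1) j : nth 0 (0 :: map val p.2) j <= m.
Proof.
case: j => [//|j] /=; have [jk|kj] := ltnP j k.
  by rewrite (nth_map ord0) ?size_tuple // -ltnS.
by rewrite nth_default // size_map size_tuple.
Qed.

Lemma deficit_data_mono p j : p \in deficit_data -> j < k ->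
  nth 0 (0 :: map val p.2) j <= nth 0 (0 :: map val p.2) j.+1.
Proof.
rewrite inE => /andP[b_sorted _] jk.
have : sorted leq (0 :: map val p.2) by rewrite /=; case: (map _ _) b_sorted.
by move/(sortedP 0); apply; rewrite /= size_map size_tuple.
Qed.

Lemma deficit_last (p : 'I_d * k.-tuple 'I_m.+1) :
  last 0 (map val p.2) = nth 0 (0 :: map val p.2) k.
Proof. by rewrite (last_nth 0) size_map size_tuple. Qed.

Lemma nth_cover_seq p j : j <= k ->
  nth 0 (cover_seq p) j = p.1 + j * d - nth 0 (0 :: map val p.2) j.
Proof. by move=> jk; rewrite nth_mkseq. Qed.

(** A deficit grows by at most [m = d - r < d] from one index to the next. *)
Lemma cover_seq_sorted p : p \in deficit_data -> sorted ltn (cover_seq p).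
Proof.
move=> pP; apply/(sortedP 0) => j; rewrite size_mkseq ltnS => jk.
rewrite !nth_cover_seq ?(ltnW jk) //.
have := deficit_data_mono pP jk; have := deficit_le p j.+1.
by rewrite /m mulSn; lia.
Qed.

Lemma cover_seq_last p : p \in deficit_data -> nth 0 (cover_seq p) k < n.
Proof.
move=> pP; move: (pP); rewrite inE => /andP[_]; rewrite deficit_last nth_cover_seq //.
by rewrite /n; lia.
Qed.

Lemma enum_cover_of p :
  p \in deficit_data -> [seq val i | i <- enum (cover_of p)] = cover_seq p.
Proof.
move=> pP; apply: (irr_sorted_eq ltn_trans ltnn).
- exact: sorted_enum_val.
- exact: cover_seq_sorted.
move=> x; apply/mapP/idP => [[i]|xc]; first by rewrite mem_enum inE => ic ->.
have x_lt : x < n.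
  case/(nthP 0): (xc) => j; rewrite size_mkseq ltnS => jk <-.
  apply: leq_ltn_trans (cover_seq_last pP).
  move: jk; rewrite leq_eqVlt => /orP[/eqP -> //|jk].
  apply/ltnW/(sorted_ltn_nth ltn_trans 0 (cover_seq_sorted pP)) => //.
    by rewrite inE size_mkseq ltnS ltnW.
  by rewrite inE size_mkseq.
by exists (Ordinal x_lt); rewrite // mem_enum inE.
Qed.

Lemma cover_of_inj : {in deficit_data &, injective cover_of}.
Proof.
move=> p q pP qP eqpq; have eqc : cover_seq p = cover_seq q.
  by rewrite -!enum_cover_of // eqpq.
have eqn j : j <= k -> p.1 + j * d - nth 0 (0 :: map val p.2) j
                     = q.1 + j * d - nth 0 (0 :: map val q.2) j.
  by move=> jk; rewrite -!nth_cover_seq // eqc.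
have eq1 : p.1 = q.1 :> nat by have := eqn 0 isT; rewrite /= !mul0n; lia.
case: p q eqn eq1 {pP qP eqpq eqc} => [a b] [a' b'] /= eqn eq1.
congr (_, _); first exact: val_inj.
apply/val_inj/(inj_map val_inj)/(@eq_from_nth _ 0); rewrite !size_map !size_tuple //.
move=> j jk; have := eqn j.+1 jk.
(* Deficits are at most [d], so the subtractions are not truncated. *)
have /= := deficit_le (a, b) j.+1; have /= := deficit_le (a', b') j.+1.
by rewrite /m mulSn; lia.
Qed.

Let d_gt0 : 0 < d := leq_trans r_gt0 le_rd.
Let le_dn : d <= n.
Proof. by apply: leq_trans (leq_addr _ _); rewrite leq_pmull. Qed.

(** Inner gaps are at most [d] because deficits do not decrease; the cyclic gap is at most [d]
    because [b_k <= d - r]. *)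
Lemma cover_of_cover p : p \in deficit_data ->
  vertex_cover (@cycle_edge n d) (cover_of p) && (#|cover_of p| == k.+1).
Proof.
move=> pP; have cE := enum_cover_of pP.
have sizec : size (cover_seq p) = k.+1 by rewrite size_mkseq.
rewrite cardE -(size_map val) cE sizec eqxx andbT.
apply/(cycle_vertex_cover_gapsP d_gt0 le_dn cE); rewrite sizec //; split=> [j jk|].
  rewrite ltnS in jk; rewrite !nth_cover_seq ?(ltnW jk) //.
  have := deficit_data_mono pP jk; rewrite mulSn.
  by move: (nth 0 _ j.+1) (nth 0 _ j) (j * d) (nat_of_ord p.1); lia.
rewrite !nth_cover_seq //= mul0n addn0 subn0 /n.
have := deficit_le p k; have : d <= k * d by rewrite leq_pmull.
by rewrite /m; move: (nth 0 _ k) (k * d) (nat_of_ord p.1); lia.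
Qed.

Lemma cover_of_surj (X : {set 'I_n}) :
    vertex_cover (@cycle_edge n d) X -> #|X| = k.+1 ->
  exists2 p, p \in deficit_data & X = cover_of p.
Proof.
move=> covX cardX; pose c := [seq val i | i <- enum X].
have sizec : size c = k.+1 by rewrite size_map -cardE.
have c_gt0 : 0 < size c by rewrite sizec.
have [gaps wrap] := (cycle_vertex_cover_gapsP d_gt0 le_dn (erefl c) c_gt0).1 covX.
rewrite sizec /= in gaps wrap.
have c_lt j : j <= k -> nth 0 c j < n.
  move=> jk; have /mapP[i _ ->] : nth 0 c j \in c by rewrite mem_nth ?sizec.
  exact: ltn_ord.
have c0 : nth 0 c 0 < d by have := c_lt k (leqnn k); lia.
have c_le j : j <= k -> nth 0 c j <= nth 0 c 0 + j * d.
  elim: j => [|j IHj] jk; first by lia.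
  have := gaps j jk; have := IHj (ltnW jk); rewrite mulSn; lia.
(* This gives [b_j <= b_k], and [wrap] says [b_k <= m], so the deficits fit in ['I_m.+1]. *)
have c_ge i j : j + i = k -> nth 0 c k <= nth 0 c j + i * d.
  elim: i j => [|i IHi] j ijk; first by rewrite -ijk !addn0.
  have jk : j < k by rewrite -ijk -addSnnS leq_addr.
  have := gaps j jk; have := IHi j.+1; rewrite addSnnS => /(_ ijk).
  by rewrite mulSn; lia.
pose b : k.-tuple 'I_m.+1 :=
  [tuple inord (nth 0 c 0 + i.+1 * d - nth 0 c i.+1) | i < k].
have bE j : j <= k ->
    nth 0 (0 :: map val b) j = nth 0 c 0 + j * d - nth 0 c j.
  case: j => [|j] jk /=; first by lia.
  rewrite (nth_map ord0) ?size_tuple ?card_ord //.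
  have -> : nth ord0 b j = tnth b (Ordinal jk) by rewrite (tnth_nth ord0).
  rewrite tnth_mktuple inordK //=.
  have := c_ge _ _ (subnKC jk); have := c_le _ jk.
  have := mulnDl (k - j.+1) j.+1 d; rewrite (subnK jk) ltnS /m.
  move: (nth 0 _ j.+1) (nth 0 _ 0) (nth 0 _ k) wrap; rewrite /n.
  move: (k * d) (_ * d) (_ * d); lia.
have pP : (Ordinal c0, b) \in deficit_data.
  rewrite inE deficit_last /= bE //; apply/andP; split.
    apply/(sortedP 0) => j; rewrite size_map size_tuple card_ord => jk.
    have := bE j.+1 (ltnW jk); have := bE j.+2 jk => /= -> ->.
    have := gaps j.+1 jk; have := c_le j.+1 (ltnW jk); have := c_le j.+2 jk.
    by rewrite !mulSn; move: (nth 0 _ _) (nth 0 _ _) (nth 0 _ _) (j * d); lia.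
  have := c_lt k (leqnn k); have := c_le k (leqnn k); rewrite /n.
  by move: (nth 0 _ _) (nth 0 _ _) (k * d); lia.
exists (Ordinal c0, b) => //.
have cE : cover_seq (Ordinal c0, b) = c.
  apply: (@eq_from_nth _ 0); rewrite size_mkseq // => j jk.
  by rewrite nth_cover_seq // bE //=; have := c_le j jk; lia.
apply/setP => i; rewrite inE cE; apply/idP/mapP => [iX|[j]].
  by exists i; rewrite ?mem_enum.
by rewrite mem_enum => jX /val_inj ->.
Qed.

(** Kept additive to avoid truncated subtraction; the second summand counts the pairs with sorted
    [p.2] that violate the strict inequality. *)
Lemma card_deficit_data : #|deficit_data| + 'C(k + m, k.+1) = d * 'C(k + m, k).
Proof.
have dE : d = r + m by rewrite /m subnKC.
rewrite -(card_sorted_tuples_top k dE) -card_sorted_tuples.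
rewrite -[X in _ = X * _](card_ord d) -cardsT -cardsX.
rewrite -[RHS](cardsID [set p : 'I_d * k.-tuple 'I_m.+1 | p.1 < r + last 0 (map val p.2)]).
congr (_ + _); apply: eq_card => p; rewrite !inE //=.
by rewrite -leqNgt andbC.
Qed.

Lemma minimum_cycle_cover_exists :
  exists2 X, vertex_cover (@cycle_edge n d) X & #|X| = k.+1.
Proof.
(* Zero deficits from vertex 0 give the cover [0, d, ..., k d]. *)
pose p := (Ordinal d_gt0, nseq_tuple k (ord0 : 'I_m.+1)).
have pP : p \in deficit_data.
  rewrite inE /= map_nseq; apply/andP; split; last by elim: (k); rewrite //= addn0.
  by elim: (k) => [|[|j]] //=.
by exists (cover_of p); have /andP[? /eqP] := cover_of_cover pP.
Qed.

Lemma card_minimum_cycle_covers :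
  #|[set X | vertex_cover (@cycle_edge n d) X & #|X| == k.+1]| + 'C(k + m, k.+1)
  = d * 'C(k + m, k).
Proof.
rewrite -card_deficit_data -(card_in_imset cover_of_inj); congr (_ + _).
apply: eq_card => X; rewrite inE; apply/andP/imsetP.
  by case=> covX /eqP /(cover_of_surj covX).
by case=> p /cover_of_cover/andP[covp cardp] ->.
Qed.

End MinimumCycleCovers.

(** * The path ideal as an edge ideal and the final formula *)

Lemma mpolyX_mnm_set (K : fieldType) n (D : {set 'I_n}) :
  'X_[mnm_set D] = \prod_(j in D) 'X_j :> {mpoly K[n]}.
Proof.
rewrite mpolyXE_id [RHS]big_mkcond; apply: eq_bigr => j _.
by rewrite mnmE; case: (j \in D).
Qed.

(** Since [d <= n], the [d] vertices of a path are distinct and the generator is squarefree. *)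
Lemma path_genE (K : fieldType) n d (i : 'I_n) : (d <= n)%N ->
  path_gen K d i = 'X_[mnm_set (cycle_edge d i)].
Proof.
move=> le_dn; rewrite mpolyX_mnm_set big_imset //= => l1 l2 _ _ /(congr1 val).
rewrite /= !val_iter_ordS => /eqP; rewrite eqn_modDl.
by rewrite !modn_small ?(leq_trans (ltn_ord _) le_dn) // => /eqP /val_inj.
Qed.

Lemma cycle_path_idealE (K : fieldType) n d : (d <= n)%N ->
  cycle_path_ideal K n d = edge_ideal K (@cycle_edge n d).
Proof.
move=> le_dn; rewrite /cycle_path_ideal.
by have -> : @path_gen K n d = fun i => 'X_[mnm_set (cycle_edge d i)]
  by apply/funext => i; apply: path_genE.
Qed.

Theorem corollary3p5 (K : fieldType) (n d k r : nat)
    (hd : (2 <= d)%N) (hk : (1 <= k)%N) (hr : (1 <= r <= d)%N)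
    (hn : n = (k * d + r)%N) (s : nat) (hs : (1 <= s)%N) :
  multiplicity (ideal_exp (cycle_path_ideal K n d) s)
    ((d%:Z * 'C(k + d - r, k)%:Z - 'C(k + d - r, k.+1)%:Z)
       * 'C(k + s, s - 1)%:Z).
Proof.
have /andP[r_gt0 le_rd] := hr.
have d_gt0 : (0 < d)%N := ltnW hd.
have le_dn : (d <= n)%N by rewrite hn (leq_trans (leq_pmull d hk)) ?leq_addr.
rewrite (cycle_path_idealE K le_dn); case: s hs => // s _.
have -> : 'C(k + s.+1, s.+1 - 1) = 'C(k.+1 + s, k.+1).
  by rewrite subn1 -addSnnS -[RHS]bin_sub ?leq_addr // addKn.
rewrite -addnBA // -PoszM -card_minimum_cycle_covers // PoszD addrK -PoszM -hn.
apply: edge_ideal_multiplicity => [X covX|].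
  (* From [k d < n <= #|X| d] it follows that [k < #|X|]. *)
  rewrite -(ltn_pmul2r d_gt0); apply: leq_trans (cycle_vertex_cover_size d_gt0 le_dn covX).
  by rewrite hn -addn1 leq_add2l.
by rewrite hn; apply: minimum_cycle_cover_exists.
Qed.
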